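(* If $k$ and $n$ are integers with $2\le k\le n$, then $E(k,n)=n+k-3+\binom{n-2}{2}$; that is, the maximum number of edges of a connected $k^*$-dense graph on $n$ vertices is $n+k-3+\binom{n-2}{2}$.
   Context: All graphs are finite and simple. For an edge $uv$ of a graph $G$, the edge multiplicity is $m_G(uv)=|N_G(u)\cap N_G(v)|$. For an integer $k\ge 2$, a graph $G$ is called $k$-dense if $G$ has no isolated vertices and every edge $uv$ of $G$ satisfies $m_G(uv)\ge k-2$. A graph is $k^*$-dense if it is $k$-dense but not $(k+1)$-dense. For positive integers $k,n$, $E(k,n)$ denotes the maximum number of edges of a connected graph on $n$ vertices that is $k^*$-dense. *)

(* Defs.v *)
From HB Require Import structures.
From mathcomp Require Import all_boot.

Set Implicit Arguments.
Unset Strict Implicit.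
Unset Printing Implicit Defensive.

                                                                      
Record sgraph (V : finType) := SGraph {
  edges : {set {set V}};
  edges_card2 : [forall e in edges, #|e| == 2]
}.

HB.instance Definition _ (V : finType) := [isSub for @edges V].
HB.instance Definition _ (V : finType) := [Finite of sgraph V by <:].

Definition adj (V : finType) (G : sgraph V) : rel V :=
  fun u v => [set u; v] \in edges G.

Definition nbhd (V : finType) (G : sgraph V) (u : V) : {set V} :=
  [set v | adj G u v].

Definition edge_mult (V : finType) (G : sgraph V) (u v : V) : nat :=
  #|nbhd G u :&: nbhd G v|.

Definition connected_graph (V : finType) (G : sgraph V) : bool :=
  [forall u, forall v, connect (adj G) u v].

Definition no_isolated (V : finType) (G : sgraph V) : bool :=
  [forall u, exists v, adj G u v].

                                                                    
Definition dense (k : nat) (V : finType) (G : sgraph V) : bool :=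
  no_isolated G &&
  [forall u, forall v, adj G u v ==> (k - 2 <= edge_mult G u v)].

Definition star_dense (k : nat) (V : finType) (G : sgraph V) : bool :=
  dense k G && ~~ dense k.+1 G.

                                                                           
                                                                      
                                               
Definition maxE (k n : nat) : nat :=
  \max_(G : sgraph 'I_n | connected_graph G && star_dense k G) #|edges G|.

(* Main.v *)
Require Import Defs.
From mathcomp Require Import all_boot.
From mathcomp Require Import zify.

Set Implicit Arguments.
Unset Strict Implicit.
Unset Printing Implicit Defensive.

(** The claimed value is [C(n, 2) - (n - k)].  A [k*]-dense graph has an edge
    [uv] of multiplicity at most [k - 2], so at least [n - k] vertices outside
    [{u, v}] miss [u] or [v]; these account for [n - k] distinct non-edges.
    Conversely, deleting a star with [n - k] edges from the complete graph gives
    a [k*]-dense graph: the centre has degree [k - 1], so the edges at the centre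
    have multiplicity exactly [k - 2], and all others have at least as much. *)

Lemma adj_sym (V : finType) (G : sgraph V) : symmetric (adj G).
Proof. by move=> u v; rewrite /adj setUC. Qed.

Lemma edge_card (V : finType) (G : sgraph V) (e : {set V}) :
  e \in edges G -> #|e| = 2.
Proof. by move=> eG; apply/eqP; exact: (forall_inP (edges_card2 G) e eG). Qed.

Lemma adj_neq (V : finType) (G : sgraph V) (u v : V) : adj G u v -> u != v.
Proof. by move=> /edge_card; rewrite cards2; case: eqP. Qed.

Lemma adj_irr (V : finType) (G : sgraph V) (u : V) : adj G u u = false.
Proof. by apply/negP => /adj_neq; rewrite eqxx. Qed.

Lemma set2_inj (V : finType) (a : V) : injective (fun x => [set a; x]).
Proof.
move=> x y /setP eq_axy; have := eq_axy x; have := eq_axy y.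
rewrite !inE !eqxx !orbT => /orP[/eqP-> | /eqP //].
by move/esym/orP=> [/eqP | /eqP].
Qed.

Lemma leq_edges_mult (V : finType) (G : sgraph V) (u v : V) :
  adj G u v -> #|edges G| + #|V| <= 'C(#|V|, 2) + edge_mult G u v + 2.
Proof.
move=> Guv; have nuv := adj_neq Guv.
pose common := nbhd G u :&: nbhd G v.
pose B := ~: ([set u; v] :|: common).
have cardB : #|B| + (2 + #|common|) = #|V|.
  have dis : [set u; v] :&: common = set0.
    apply/setP=> x; rewrite !inE; apply/negbTE/negP.
    by move=> /andP[/orP[]/eqP->]; rewrite ?adj_irr ?andbF.
  by rewrite -(cardsC B) setCK cardsU dis cards0 subn0 cards2 nuv.
(* A vertex [w] of [B] adjacent to [u] must miss [v], so [f w] is always a non-edge. It determines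
   [w], its only element outside [{u, v}]. *)
pose f w := [set (if adj G u w then v else u); w].
have f_inj : {in B &, injective f}.
  move=> x y; rewrite !inE !negb_or => /andP[/andP[xu xv] _].
  move=> /andP[/andP[yu yv] _] /setP/(_ x).
  rewrite !inE eqxx orbT => /esym/orP[|/eqP //].
  by case: ifP => _; rewrite (negbTE xu, negbTE xv).
have fB : f @: B \subset [set e : {set V} | #|e| == 2] :\: edges G.
  apply/subsetP=> _ /imsetP[w wB ->]; move: wB; rewrite !inE !negb_or negb_and.
  move=> /andP[/andP[wu wv] nGw]; rewrite cards2 -/(adj G _ w).
  by case Guw: (adj G u w) nGw; rewrite /= ![_ == w]eq_sym ?wu ?wv ?Guw // andbT.
have sub : edges G \subset [set e : {set V} | #|e| == 2].
  by apply/subsetP=> e /edge_card; rewrite inE => ->.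
have := subset_leq_card fB; rewrite (card_in_imset f_inj).
have := subset_leq_card sub.
rewrite cardsD (setIidPr sub) card_draws /edge_mult -/common /reverse_coercion.
lia.
Qed.

Section StarDeleted.

Variables (V : finType) (c : V) (B : {set V}).

Definition star_deleted_edges : {set {set V}} :=
  [set e : {set V} | #|e| == 2] :\: [set [set c; x] | x in B].

Fact star_deleted_card2 : [forall e in star_deleted_edges, #|e| == 2].
Proof. by apply/forall_inP=> e; rewrite !inE => /andP[]. Qed.

Definition star_deleted : sgraph V := SGraph star_deleted_card2.

Hypothesis cNB : c \notin B.

Lemma star_deleted_card : #|edges star_deleted| + #|B| = 'C(#|V|, 2).
Proof.
have sub : [set [set c; x] | x in B] \subset [set e : {set V} | #|e| == 2].
  apply/subsetP=> _ /imsetP[x xB ->]; rewrite inE cards2.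
  by rewrite (_ : c != x) //; apply: contraNneq cNB => ->.
have := subset_leq_card sub.
rewrite /= /star_deleted_edges cardsD (setIidPr sub) card_draws.
rewrite (card_imset _ (@set2_inj V c)); exact: subnK.
Qed.

Lemma star_deleted_adj_center v :
  adj star_deleted c v = (v != c) && (v \notin B).
Proof.
rewrite /adj /= in_setD inE cards2 (mem_imset _ _ (@set2_inj V c)) andbC.
by rewrite (eq_sym v); case: (c != v).
Qed.

Lemma star_deleted_adj u v :
  u != c -> v != c -> adj star_deleted u v = (u != v).
Proof.
move=> uc vc; rewrite /adj /= !inE cards2.
case: (boolP (_ \in _ @: _)) => [/imsetP[x _ /setP/(_ c)] | _]; last by case: (u != v).
by rewrite !inE eqxx ![c == _]eq_sym (negbTE uc) (negbTE vc).
Qed.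

Hypothesis cardB : #|B| + 2 <= #|V|.

(** By [cardB] some vertex lies outside [c |: B]. Such a vertex is adjacent to all others, which
    yields connectedness and the absence of isolated vertices; its edge to [c] caps the density. *)
Lemma star_deleted_leaf : exists v, adj star_deleted c v.
Proof.
have /set0Pn[v] : ~: (c |: B) != set0.
  by rewrite -card_gt0 cardsCs setCK cardsU1 cNB; lia.
by rewrite !inE negb_or => ?; exists v; rewrite star_deleted_adj_center.
Qed.

Lemma star_deleted_connected : connected_graph star_deleted.
Proof.
have [v cv] := star_deleted_leaf.
have vc : v != c by rewrite eq_sym (adj_neq cv).
have toc u : connect (adj star_deleted) u c.
  have [-> //|uc] := eqVneq u c.
  apply: (@connect_trans _ _ v); last by rewrite connect1 // adj_sym.
  by have [-> //|uv] := eqVneq u v; rewrite connect1 // star_deleted_adj.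
apply/forallP=> x; apply/forallP=> y; apply: (connect_trans (toc x)).
by rewrite (sym_connect_sym (@adj_sym V star_deleted)).
Qed.

(** The common neighbours of [c] and [v] are exactly the vertices outside [B] other than [c] and
    [v]. The additive form avoids truncated subtraction. *)
Lemma star_deleted_mult_center v :
  adj star_deleted c v -> edge_mult star_deleted c v + #|B| + 2 = #|V|.
Proof.
rewrite star_deleted_adj_center => /andP[vc vB].
rewrite /edge_mult (_ : _ :&: _ = ~: (v |: (c |: B))).
  rewrite -(cardsC (v |: (c |: B))) !cardsU1 !inE (negbTE vc) (negbTE vB) cNB.
  lia.
apply/setP=> x; rewrite !inE star_deleted_adj_center.
have [-> //=|xc] := eqVneq x c; first by rewrite orbT.
by rewrite star_deleted_adj //= eq_sym negb_or andbC.
Qed.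

Lemma star_deleted_mult u v :
  adj star_deleted u v -> #|V| <= edge_mult star_deleted u v + #|B| + 2.
Proof.
move=> uv; have [uc|uc] := eqVneq u c.
  by rewrite -(star_deleted_mult_center (v := v)) ?uc // -uc.
have [vc|vc] := eqVneq v c.
  rewrite -(star_deleted_mult_center (v := u)) /edge_mult 1?setIC ?vc //.
  by rewrite adj_sym -vc.
have sub : ~: [set u; v; c] \subset nbhd star_deleted u :&: nbhd star_deleted v.
  apply/subsetP=> x; rewrite !inE !negb_or -andbA => /and3P[xu xv xc].
  by rewrite !star_deleted_adj // ![_ == x]eq_sym xu xv.
(* Counting only common neighbours other than [c] gives [#|V| - 3], enough once [B] is nonempty. If
   [B] is empty the graph is complete, and [c] is a common neighbour too, which supplies the missing
   one. *)
have [B0|] := posnP #|B|; last first.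
  have := subset_leq_card sub; have := cardsC [set u; v; c].
  have := cardsU [set u; v] [set c]; rewrite cards1 cards2 /edge_mult.
  lia.
have sub' : ~: [set u; v] \subset nbhd star_deleted u :&: nbhd star_deleted v.
  apply/subsetP=> x; have [-> _|xc] := eqVneq x c.
    have BE := cards0_eq B0.
    by rewrite !inE ![adj _ _ c]adj_sym !star_deleted_adj_center uc vc BE !inE.
  rewrite !inE !negb_or => /andP[xu xv].
  by rewrite !star_deleted_adj // ![_ == x]eq_sym xu xv.
have := subset_leq_card sub'; have := cardsC [set u; v].
rewrite cards2 /edge_mult; lia.
Qed.

Lemma star_deleted_star_dense : star_dense (#|V| - #|B|) star_deleted.
Proof.
have [v cv] := star_deleted_leaf.
apply/andP; split; last first.
  (* The edge [cv] has multiplicity [#|V| - #|B| - 2], one less than the next density level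
     demands. *)
  apply/negP => /andP[_ /forallP/(_ c)/forallP/(_ v)/implyP/(_ cv)].
  have := star_deleted_mult_center cv; lia.
apply/andP; split.
  apply/forallP=> u; apply/existsP; have [->|uc] := eqVneq u c; first by exists v.
  have [->|uv] := eqVneq u v; first by exists c; rewrite adj_sym.
  exists v; rewrite star_deleted_adj //.
  by rewrite eq_sym (adj_neq cv).
apply/forallP=> x; apply/forallP=> y; apply/implyP=> /star_deleted_mult; lia.
Qed.

End StarDeleted.

Lemma card_ord_geq (n k : nat) : #|[set x : 'I_n | k <= x]| = n - k.
Proof.
rewrite cardsE -sum1_card -[RHS]muln1 -sum_nat_const_nat big_geq_mkord.
exact: eq_bigl.
Qed.

Theorem theorem6p2 (k n : nat) (hk : 2 <= k) (hkn : k <= n) :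
  maxE k n = n + k - 3 + 'C(n - 2, 2).
Proof.
(* Pascal's rule gives [C(n, 2) = C(n - 2, 2) + 2(n - 2) + 1], and
   [(n + k - 3) + (n - k) = 2n - 3]. *)
have binE : n + k - 3 + 'C(n - 2, 2) + (n - k) = 'C(n, 2).
  have n2 : n = (n - 2).+2 by lia.
  by rewrite [in RHS]n2 !binS !bin1 bin0; lia.
apply/eqP; rewrite eqn_leq; apply/andP; split.
  apply/bigmax_leqP=> G /andP[_ /andP[/andP[iso _]]].
  (* As [G] has no isolated vertices, [k.+1]-density can only fail at an edge, whose multiplicity is
     then below [k - 1]. *)
  rewrite /dense iso negb_forall => /existsP[u].
  rewrite negb_forall => /existsP[v]; rewrite negb_imply => /andP[uv].
  have := leq_edges_mult uv; rewrite card_ord; lia.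
have n0 : 0 < n by lia.
(* The centre is vertex 0 and the star's leaves are the last [n - k] vertices; [2 <= k] keeps 0 out
   of [B] and leaves it a neighbour. *)
pose c := Ordinal n0; pose B := [set x : 'I_n | k <= x].
have cNB : c \notin B by rewrite inE -ltnNge /=; lia.
have cardB : #|B| = n - k := card_ord_geq n k.
have B2 : #|B| + 2 <= #|'I_n| by rewrite cardB card_ord; lia.
have -> : n + k - 3 + 'C(n - 2, 2) = #|edges (star_deleted c B)|.
  by have := star_deleted_card cNB; rewrite card_ord cardB; lia.
apply: (@leq_bigmax_cond _ _ (fun G : sgraph 'I_n => #|edges G|)).
rewrite star_deleted_connected //=.
have := star_deleted_star_dense cNB B2.
by rewrite card_ord cardB subKn.
Qed.
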